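(* Let $n\ge1$ be an integer, let $0<\alpha<n$ be real, and put $q_{n,\alpha,\alpha}=(4n-4\alpha+2\alpha)/\alpha=(4n-2\alpha)/\alpha$. For every $q$ with $0<q<q_{n,\alpha,\alpha}$ there exist constants $C_1,C_2,c>0$, $p_0$ and $\tau=\tau_{n,\alpha,q}>0$, depending only on $n,\alpha,q$, such that for each field $\mathbb{F}$ of prime order $|\mathbb{F}|\ge p_0$ there exists a probability measure $\mu$ on $\mathbb{F}^n$ with $$\mu(x)\le C_1|\mathbb{F}|^{-\alpha}\ \text{ for all }x\in\mathbb{F}^n,\qquad |\widehat{\mu}(\xi)|\le C_2|\mathbb{F}|^{-\alpha/2}\ \text{ for all }\xi\in\mathbb{F}^n,\ \xi\ne0,$$ and $$R^*_\mu(2\to q)\ge c\,|\mathbb{F}|^{\tau}.$$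
   Context: $\mathbb{F}$ is the finite field with $|\mathbb{F}|$ elements, $|\mathbb{F}|$ prime. A measure on $\mathbb{F}^n$ is a function $\mu:\mathbb{F}^n\to[0,\infty)$; it is a probability measure if $\sum_{x\in\mathbb{F}^n}\mu(x)=1$. For $x,\xi\in\mathbb{F}^n$ let $x\cdot\xi=x_1\xi_1+\cdots+x_n\xi_n \pmod{|\mathbb{F}|}$ and $e(-x\cdot\xi)=e^{-2\pi i\, x\cdot\xi/|\mathbb{F}|}$. For $f:\mathbb{F}^n\to\mathbb{C}$, $$\widehat{f\mu}(\xi)=\sum_{x\in\mathbb{F}^n}e(-x\cdot\xi)f(x)\mu(x),\qquad \widehat{\mu}(\xi)=\sum_{x\in\mathbb{F}^n}e(-x\cdot\xi)\mu(x).$$ For $0<q<\infty$ put $\|f\|_{L^q(\mathbb{F}^n)}=\big(\sum_x|f(x)|^q\big)^{1/q}$ and $\|f\|_{L^q(\mu)}=\big(\sum_x|f(x)|^q\mu(x)\big)^{1/q}$ (for $q<1$ these are the same expressions, though not norms). $R^*_\mu(2\to q)$ is the smallest constant $R$ such that $\|\widehat{f\mu}\|_{L^q(\mathbb{F}^n)}\le R\,\|f\|_{L^2(\mu)}$ for all complex functions $f$ on the support of $\mu$. *)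

(* Defs.v *)
From mathcomp Require Import all_boot all_order all_algebra.
From mathcomp Require Import reals exp trigo.
From mathcomp Require Import classical_sets.
From mathcomp.real_closed Require Import complex.

Set Implicit Arguments.
Unset Strict Implicit.
Unset Printing Implicit Defensive.

Import Order.TTheory GRing.Theory Num.Theory.
Local Open Scope ring_scope.
Local Open Scope complex_scope.

Definition expi (R : realType) (t : R) : R[i] := cos t +i* sin t.

Definition dot (p n : nat) (x xi : 'rV['F_p]_n) : 'F_p :=
  \sum_(i < n) x 0 i * xi 0 i.

(* exp(-2 pi i (x . xi) / p); an element of 'F_p is read as its representative
   in {0, ..., p - 1}. *)
Definition fourier_kernel (R : realType) (p n : nat) (x xi : 'rV['F_p]_n) :
    R[i] :=
  expi (- (2 * pi * (nat_of_ord (dot x xi))%:R / p%:R)).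

Definition fourier (R : realType) (p n : nat) (g : 'rV['F_p]_n -> R[i])
    (xi : 'rV['F_p]_n) : R[i] :=
  \sum_(x : 'rV['F_p]_n) fourier_kernel R x xi * g x.

Definition is_probability (R : realType) (p n : nat)
    (mu : 'rV['F_p]_n -> R) : Prop :=
  (forall x, 0 <= mu x) /\ \sum_(x : 'rV['F_p]_n) mu x = 1.

Definition norm_count (R : realType) (p n : nat) (q : R)
    (g : 'rV['F_p]_n -> R[i]) : R :=
  (\sum_(x : 'rV['F_p]_n) (Normc.normc (g x)) `^ q) `^ q^-1.

Definition norm_mu (R : realType) (p n : nat) (mu : 'rV['F_p]_n -> R) (q : R)
    (f : 'rV['F_p]_n -> R[i]) : R :=
  (\sum_(x : 'rV['F_p]_n) (Normc.normc (f x)) `^ q * mu x) `^ q^-1.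

(* Both sides depend only on the values of f on the support of mu, so f may as
   well range over all functions on the whole space. *)
Definition restriction_bound (R : realType) (p n : nat)
    (mu : 'rV['F_p]_n -> R) (q C : R) : Prop :=
  0 <= C /\
  forall f : 'rV['F_p]_n -> R[i],
    norm_count q (fourier (fun x => f x * (mu x)%:C)) <= C * norm_mu mu 2 f.

(* The infimum is attained (Rstar_min below), so this is the smallest constant. *)
Definition Rstar (R : realType) (p n : nat) (mu : 'rV['F_p]_n -> R) (q : R) :
    R :=
  inf [set C : R | restriction_bound mu q C]%classic.

Lemma normc_ge0 (R : rcfType) (z : R[i]) : 0 <= Normc.normc z.
Proof. by case: z => a b; exact: sqrtr_ge0. Qed.

Lemma normc_sum (R : rcfType) (T : finType) (F : T -> R[i]) :
  Normc.normc (\sum_t F t) <= \sum_t Normc.normc (F t).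
Proof.
elim/big_ind2: _ => [|a b c d h1 h2|//]; first by rewrite Normc.normc0.
by apply: le_trans (lerD h1 h2); exact: le_normcD.
Qed.

Lemma Rstar_ex (R : realType) (p n : nat) (mu : 'rV['F_p]_n -> R) (q : R) :
  (forall x, 0 <= mu x) -> 0 < q -> exists C, restriction_bound mu q C.
Proof.
move=> mu0 q0.
set S := \sum_(x : 'rV['F_p]_n) Num.sqrt (mu x).
have S0 : 0 <= S by apply: sumr_ge0 => x _; exact: sqrtr_ge0.
set K := (#|{: 'rV['F_p]_n}|%:R : R).
exists (K `^ q^-1 * S); split; first by rewrite mulr_ge0 ?powR_ge0.
move=> f; set N := norm_mu mu 2 f.
have N0 : 0 <= N by exact: powR_ge0.
have fN x : Normc.normc (f x) * mu x <= Num.sqrt (mu x) * N.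
  rewrite -{1}(sqr_sqrtr (mu0 x)) expr2 mulrA mulrC ler_wpM2l ?sqrtr_ge0//.
  rewrite /N /norm_mu powR12_sqrt; last first.
    by apply: sumr_ge0 => y _; rewrite mulr_ge0 ?powR_ge0.
  rewrite -{1}(ger0_norm (normc_ge0 (f x))) -sqrtr_sqr -sqrtrM ?sqr_ge0//.
  apply: ler_wsqrtr; rewrite (bigD1 x)//= powR_mulrn ?normc_ge0// lerDl.
  by apply: sumr_ge0 => y _; rewrite mulr_ge0 ?powR_ge0.
have FN xi : Normc.normc (fourier (fun x => f x * (mu x)%:C) xi) <= S * N.
  apply: (le_trans (normc_sum _)); rewrite /S mulr_suml; apply: ler_sum => x _.
  rewrite !Normc.normcM; apply: le_trans (fN x).
  rewrite /= cos2Dsin2 sqrtr1 mul1r expr0n /= addr0 sqrtr_sqr.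
  by rewrite ger0_norm.
rewrite /norm_count.
have -> : K `^ q^-1 * S * N = (\sum_(x : 'rV['F_p]_n) (S * N) `^ q) `^ q^-1.
  rewrite sumr_const -[_ *+ _]mulr_natl powRM ?powR_ge0 ?ler0n//.
  by rewrite -powRrM mulfV ?gt_eqF// powRr1 ?mulr_ge0// mulrA.
have s0 (g : 'rV['F_p]_n -> R) : 0 <= \sum_x (g x) `^ q.
  by apply: sumr_ge0 => x _; exact: powR_ge0.
apply: ge0_ler_powR; rewrite ?nnegrE ?s0 ?invr_ge0 ?(ltW q0)//.
apply: ler_sum => x _; apply: ge0_ler_powR; rewrite ?nnegrE ?normc_ge0 ?mulr_ge0 ?(ltW q0)//.
Qed.

Lemma Rstar_min (R : realType) (p n : nat) (mu : 'rV['F_p]_n -> R) (q : R) :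
  (forall x, 0 <= mu x) -> 0 < q ->
  restriction_bound mu q (Rstar mu q) /\
  forall C, restriction_bound mu q C -> Rstar mu q <= C.
Proof.
move=> mu0 q0; have [C0 hC0] := Rstar_ex mu0 q0.
have lb : has_inf [set C : R | restriction_bound mu q C]%classic.
  by split; [exists C0|exists 0 => C []].
split; last by move=> C hC; apply: (ge_inf (proj2 lb)).
split; first by apply: lb_le_inf (proj1 lb) _ => C [].
move=> f; have [N0|N0] := ltrP 0 (norm_mu mu 2 f).
  rewrite -ler_pdivrMr//; apply: lb_le_inf (proj1 lb) _ => C [_ hC].
  by rewrite ler_pdivrMr.
have N1 : norm_mu mu 2 f = 0.
  by apply/eqP; rewrite eq_le N0 powR_ge0.
by have := hC0.2 f; rewrite N1 !mulr0.
Qed.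

(* Main.v *)
Require Import Defs.
From mathcomp Require Import all_boot all_order all_algebra.
From mathcomp Require Import reals exp trigo.
From mathcomp.real_closed Require Import complex.
From mathcomp Require Import ring lra.

(** The measure is the uniform measure with a spike: it gives an extra mass
    [a = p^(-alpha)] to each point of a discrete box [E] with about
    [p^(alpha/2)] points.

    The uniform part has no nonzero frequency, so for [xi != 0] the Fourier
    transform of the measure is that of [a 1_E], which is trivially at most
    [a |E| <= p^(-alpha/2)]; the spike is small enough for the decay to hold
    whatever the shape of [E] ([fourier_spike_le]).  The uniform density is
    at most [p^(-n) <= p^(-alpha)], so the pointwise bound holds as well.

    The shape of [E] enters in the lower bound, which is a Knapp example.
    Test the inequality on [f = 1_E].  If [E] is a box of side [M], then on the
    dual box [F] of side about [p / (8 n M)] all phases [x . xi / p] are at most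
    1/8 of a turn, so there is no cancellation and the transform of [f mu] on
    [F] is comparable to [mu E].  Comparing norms ([Rstar_knapp]) gives
    [Rstar >= k (mu E)^(1/2) |F|^(1/q)] with [k = cos (pi / 4)].  Here
    [mu E >= a |E|], which is comparable to [p^(-alpha/2)], and [|F|] is
    comparable to [p^n / |E|], that is to [p^(n - alpha/2)]; so the exponent of
    [p] obtained is
    [tau = (n - alpha/2)/q - alpha/4], which is positive exactly when
    [q < (4 n - 2 alpha)/alpha]. *)

Set Implicit Arguments.
Unset Strict Implicit.
Unset Printing Implicit Defensive.

Import Order.TTheory GRing.Theory Num.Theory.
Local Open Scope ring_scope.
Local Open Scope complex_scope.

(** * Additive characters *)

Lemma expiD (R : realType) (s t : R) : expi (s + t) = expi s * expi t.
Proof.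
rewrite /expi cosD sinD; apply/eqP; rewrite eq_complex /= eqxx /=.
by rewrite addrC.
Qed.

Lemma expiMn (R : realType) (t : R) (k : nat) : expi (t *+ k) = expi t ^+ k.
Proof.
elim: k => [|k IH]; first by rewrite mulr0n expr0 /expi cos0 sin0.
by rewrite mulrS expiD IH exprS.
Qed.

Lemma normc_expi (R : realType) (t : R) : Normc.normc (expi t) = 1.
Proof. by rewrite /= cos2Dsin2 sqrtr1. Qed.

Lemma ler_cos (R : realType) (x y : R) :
  0 <= x -> x <= y -> y <= pi -> cos y <= cos x.
Proof.
move=> x0; rewrite le_eqVlt => /orP[/eqP->//|xy] ypi; apply/ltW.
have y0 := le_trans x0 (ltW xy); have xpi := le_trans (ltW xy) ypi.
by rewrite ltr_cos// in_itv/= ?x0 ?y0 ?xpi ?ypi.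
Qed.

(** The primitive [p]-th root of unity [exp(-2 pi i / p)]; writing the Fourier
    kernel as a power of it turns reduction mod [p] into [expr_mod]. *)
Definition proot (R : realType) (p : nat) : R[i] := expi (- (2 * pi / p%:R)).

Lemma proot_expr (R : realType) (p : nat) : (0 < p)%N -> proot R p ^+ p = 1.
Proof.
move=> p0; rewrite /proot -expiMn -[X in expi X]mulr_natr mulNr.
rewrite mulfVK ?pnatr_eq0 -?lt0n//.
by rewrite /expi cosN sinN mulr_natl cos2pi sin2pi oppr0.
Qed.

Lemma proot_neq1 (R : realType) (p : nat) : (1 < p)%N -> proot R p != 1.
Proof.
move=> p1; have p0 : 0 < p%:R :> R by rewrite ltr0n ltnW.
have h2 : (2 : R) <= p%:R by rewrite ler_nat.
have pi0 := @pi_gt0 R.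
rewrite /proot /expi cosN eq_complex /= negb_and; apply/orP; left.
rewrite lt_eqF// -[X in _ < X]cos0.
rewrite ltr_cos ?in_itv/= ?lexx ?pi_ge0 ?divr_gt0 ?mulr_gt0//.
by rewrite ler_pdivrMr// [pi * _]mulrC ler_pM2r// divr_ge0 ?mulr_ge0 ?pi_ge0.
Qed.

Lemma fourier_kernelE (R : realType) (p n : nat) (x xi : 'rV['F_p]_n) :
  fourier_kernel R x xi = proot R p ^+ nat_of_ord (dot x xi).
Proof.
rewrite /fourier_kernel /proot -expiMn; congr expi.
by rewrite -[RHS]mulr_natr mulNr mulrAC.
Qed.

Lemma normc_fourier_kernel (R : realType) (p n : nat) (x xi : 'rV['F_p]_n) :
  Normc.normc (fourier_kernel R x xi) = 1.
Proof. exact: normc_expi. Qed.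

Lemma dotDl (p n : nat) (x y xi : 'rV['F_p]_n) :
  dot (x + y) xi = dot x xi + dot y xi.
Proof.
by rewrite /dot -big_split /=; apply: eq_bigr => i _; rewrite mxE mulrDl.
Qed.

Lemma val_FpD (p : nat) (a b : 'F_p) : prime p ->
  nat_of_ord (a + b) = ((nat_of_ord a + nat_of_ord b) %% p)%N.
Proof.
move=> pp /=.
(* The modulus also occurs in the types of a and b, hence the generalization. *)
by move: (nat_of_ord a) (nat_of_ord b) => k l; rewrite Fp_cast.
Qed.

Lemma fourier_kernelD (R : realType) (p n : nat) (x y xi : 'rV['F_p]_n) :
  prime p ->
  fourier_kernel R (x + y) xi = fourier_kernel R x xi * fourier_kernel R y xi.
Proof.
move=> pp; rewrite !fourier_kernelE dotDl -exprD val_FpD//.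
by rewrite expr_mod// proot_expr// prime_gt0.
Qed.

(** Translating by a [y] with [y . xi = 1] multiplies the sum by a nontrivial
    root of unity, yet only permutes its terms. *)
Lemma sum_fourier_kernel (R : realType) (p n : nat) (xi : 'rV['F_p]_n) :
  prime p -> xi != 0 -> \sum_x fourier_kernel R x xi = 0.
Proof.
move=> pp /rV0Pn[i xi0].
pose y : 'rV['F_p]_n := (xi 0 i)^-1 *: delta_mx 0 i.
have doty : dot y xi = 1.
  rewrite /dot (bigD1 i)//= big1 => [|j ji].
    by rewrite !mxE !eqxx mulr1 addr0 mulVf.
  by rewrite !mxE eqxx (negbTE ji) mulr0 mul0r.
have ky : fourier_kernel R y xi != 1.
  by rewrite fourier_kernelE doty /= expr1 proot_neq1// prime_gt1.
set S := \sum_x _.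
have : S * fourier_kernel R y xi = S.
  rewrite [RHS](reindex_inj (addIr y))/= mulr_suml.
  by apply: eq_bigr => x _; rewrite fourier_kernelD.
move/eqP; rewrite -subr_eq0 -{2}[S]mulr1 -mulrBr mulf_eq0 subr_eq0 (negbTE ky).
by rewrite orbF => /eqP.
Qed.

(** * Boxes and their dual boxes *)

Definition box (p n K : nat) : {set 'rV['F_p]_n} :=
  [set x : 'rV['F_p]_n | [forall i, (nat_of_ord (x 0%R i) < K)%N]].

Lemma card_ord_lt (m K : nat) : (K <= m)%N ->
  #|[pred k : 'I_m | (k < K)%N]| = K.
Proof.
move=> Km; rewrite -sum1_card /= (big_ord_narrow Km) /=.
by rewrite sum1_card card_ord.
Qed.

Lemma card_box (p n K : nat) : prime p -> (K <= p)%N ->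
  #|box p n K| = (K ^ n)%N.
Proof.
move=> pp Kp.
pose toV (f : {ffun 'I_n -> 'F_p}) : 'rV['F_p]_n := \row_i f i.
have toV_inj : injective toV.
  by move=> f g /rowP E; apply/ffunP => i; have := E i; rewrite !mxE.
have -> : box p n K = toV @: ffun_on [pred k : 'F_p | (nat_of_ord k < K)%N].
  apply/setP => x; rewrite inE; apply/forallP/imsetP => [H|[f /ffun_onP fK ->] i].
    exists [ffun i => (x : 'rV_n) 0 i]; last first.
      by apply/rowP => i; rewrite !mxE ffunE.
    by apply/ffun_onP => i; rewrite ffunE inE.
  by rewrite mxE; exact: fK.
by rewrite card_imset// card_ffun_on card_ord_lt ?Fp_cast// card_ord.
Qed.

Lemma dot_box_le (p n M L : nat) (x xi : 'rV['F_p]_n) : prime p ->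
  (8 * (n * (M * L)) <= p)%N -> x \in box p n M -> xi \in box p n L.+1 ->
  (8 * nat_of_ord (dot x xi) <= p)%N.
Proof.
move=> pp nML; rewrite !inE => /forallP xM /forallP xiL.
apply: leq_trans nML; rewrite leq_mul2l /=.
have -> : (n * (M * L) = \sum_(i < n) M * L)%N by rewrite sum_nat_const card_ord.
(* Reduction mod p only decreases representatives. *)
rewrite /dot; elim/big_ind2: _ => [|a s b t h1 h2|i _]; first by [].
  by apply: leq_trans (leq_mod _ _) _; exact: leq_add.
apply: leq_trans (leq_mod _ _) _.
by apply: leq_mul; [exact: ltnW|rewrite -ltnS].
Qed.

(** Between a box and its dual box the phases span at most 1/8 of a turn, so the
    kernel has a real part bounded below. *)
Lemma Re_fourier_kernel_box (R : realType) (p n M L : nat)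
    (x xi : 'rV['F_p]_n) :
  prime p -> (8 * (n * (M * L)) <= p)%N ->
  x \in box p n M -> xi \in box p n L.+1 ->
  cos (pi / 4) <= complex.Re (fourier_kernel R x xi).
Proof.
move=> pp nML xM xiL; have := dot_box_le pp nML xM xiL.
rewrite /= cosN; set d := nat_of_ord _ => dp.
have pi0 := @pi_gt0 R; have p0 : 0 < p%:R :> R by rewrite ltr0n prime_gt0.
apply: ler_cos; first by rewrite !(divr_ge0, mulr_ge0)// ltW.
  rewrite ler_pdivrMr//; have : (8 * d)%:R <= p%:R :> R by rewrite ler_nat.
  by rewrite natrM; nra.
by lra.
Qed.

(** * The Knapp lower bound *)

Lemma ler_Re_normc (R : rcfType) (z : R[i]) : complex.Re z <= Normc.normc z.
Proof.
case: z => a b /=; apply: le_trans (ler_norm a) _; rewrite -sqrtr_sqr.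
by apply: ler_wsqrtr; rewrite lerDl sqr_ge0.
Qed.

Lemma Re_sum (R : rcfType) (T : finType) (A : pred T) (F : T -> R[i]) :
  complex.Re (\sum_(t | A t) F t) = \sum_(t | A t) complex.Re (F t).
Proof. by apply: (big_morph (@complex.Re R)) => // -[a b] [c d]. Qed.

(** Testing on the indicator of [E]: without cancellation on [F], the transform
    has size at least [k * mu E] there, against an L^2 norm [(mu E)^(1/2)]. *)
Lemma Rstar_knapp (R : realType) (p n : nat) (mu : 'rV['F_p]_n -> R) (q k w : R)
    (E F : {set 'rV['F_p]_n}) :
  (forall x, 0 <= mu x) -> 0 < q -> 0 <= k -> 0 < w -> (0 < #|E|)%N ->
  (forall x, x \in E -> mu x = w) ->
  (forall x xi, x \in E -> xi \in F ->
    k <= complex.Re (fourier_kernel R x xi)) ->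
  k * (w * #|E|%:R) `^ 2^-1 * #|F|%:R `^ q^-1 <= Rstar mu q.
Proof.
move=> mu0 q0 k0 w0 E0 muE kEF.
have [[_ /(_ (fun x => (x \in E)%:R)) test] _] := Rstar_min mu0 q0; move: test.
set W := w * #|E|%:R; have W0 : 0 < W by rewrite mulr_gt0 ?ltr0n.
have -> : norm_mu mu 2 (fun x => (x \in E)%:R) = W `^ 2^-1.
  rewrite /norm_mu; congr (_ `^ _).
  transitivity (\sum_(x in E) w); last by rewrite sumr_const /W mulr_natr.
  rewrite [RHS]big_mkcond /=; apply: eq_bigr => x _.
  case: ifP => xE; last by rewrite Normc.normc0 powR0 ?mul0r ?pnatr_eq0.
  by rewrite Normc.normc1 powR1 mul1r muE.
have lower xi : xi \in F ->
    k * W <= Normc.normc (fourier (fun x => (x \in E)%:R * (mu x)%:C) xi).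
  move=> xiF; apply: le_trans (ler_Re_normc _).
  rewrite /fourier Re_sum.
  have -> : k * W = \sum_(x in E) k * w.
    by rewrite sumr_const /W mulrA mulr_natr.
  rewrite [leLHS]big_mkcond /=; apply: ler_sum => x _.
  case: ifP => xE; last by rewrite mul0r mulr0.
  rewrite mul1r muE//; move: (kEF x xi xE xiF).
  case: (fourier_kernel _ _ _) => a b /=.
  by rewrite mulr0 subr0 ler_pM2r.
move=> knapp.
rewrite -(ler_pM2r (powR_gt0 2^-1 W0)); apply: le_trans knapp.
rewrite mulrAC -(mulrA k) -powRD; last first.
  by rewrite (gt_eqF W0) implybT.
have -> : 2^-1 + 2^-1 = 1 :> R by lra.
rewrite powRr1 ?(ltW W0)// /norm_count.
have -> : k * W * #|F|%:R `^ q^-1 = (\sum_(xi in F) (k * W) `^ q) `^ q^-1.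
  rewrite sumr_const -[X in _ = X `^ _]mulr_natl powRM ?powR_ge0 ?ler0n//.
  by rewrite -powRrM mulfV ?gt_eqF// powRr1 ?mulr_ge0 ?(ltW w0)// mulrC.
apply: ge0_ler_powR; rewrite ?nnegrE ?sumr_ge0 ?invr_ge0 ?(ltW q0)//.
  by move=> *; exact: powR_ge0.
  by move=> *; exact: powR_ge0.
rewrite [leLHS]big_mkcond /=; apply: ler_sum => xi _.
case: ifP => xiF; last exact: powR_ge0.
by apply: ge0_ler_powR;
  rewrite ?nnegrE ?mulr_ge0 ?normc_ge0 ?(ltW q0) ?(ltW w0) ?lower.
Qed.

(** * Uniform measures with a spike *)

Definition spike (R : realType) (p n : nat) (E : {set 'rV['F_p]_n}) (a b : R)
    (x : 'rV['F_p]_n) : R :=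
  (x \in E)%:R * a + b.

Lemma sum_spike (R : realType) (p n : nat) (E : {set 'rV['F_p]_n}) (a b : R) :
  prime p -> \sum_x spike E a b x = #|E|%:R * a + p%:R ^+ n * b.
Proof.
move=> pp; rewrite big_split /= -mulr_suml sumr_const; congr (_ * _ + _).
  by rewrite -sumr_const [RHS]big_mkcond; apply: eq_bigr => x _;
    case: (x \in E).
by rewrite -[LHS]mulr_natl cardT -cardE card_mx card_Fp// mul1n natrX.
Qed.

(** The constant [b] contributes nothing away from the frequency 0, and the
    spike contributes at most its total mass. *)
Lemma fourier_spike_le (R : realType) (p n : nat) (E : {set 'rV['F_p]_n})
    (a b : R) (xi : 'rV['F_p]_n) :
  prime p -> 0 <= a -> xi != 0 ->
  Normc.normc (fourier (fun x => (spike E a b x)%:C) xi) <= #|E|%:R * a.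
Proof.
move=> pp a0 xi0.
have -> : fourier (fun x => (spike E a b x)%:C) xi =
    \sum_x fourier_kernel R x xi * ((x \in E)%:R * a)%:C.
  rewrite /fourier /spike; under eq_bigr do rewrite rmorphD /= mulrDr.
  by rewrite big_split /= -mulr_suml sum_fourier_kernel// mul0r addr0.
apply: le_trans (normc_sum _) _.
rewrite mulr_natl -sumr_const [leRHS]big_mkcond; apply: ler_sum => x _.
rewrite Normc.normcM normc_fourier_kernel mul1r /= expr0n /= addr0 sqrtr_sqr.
by case: (x \in E); rewrite ?mul1r ?mul0r ?normr0// ger0_norm.
Qed.

(** * Choice of the scales *)

(** A box of side [floor (p^(s/n))] has [p^s] points up to the factor [2^n] lost
    by rounding, since that side is at least 1. *)
Lemma box_side (R : realType) (n : nat) (s : R) (p : nat) :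
  0 < s <= n%:R -> (0 < n)%N -> (0 < p)%N ->
  exists M : nat, [/\ (0 < M)%N, (M <= p)%N, (M ^ n)%:R <= p%:R `^ s
                    & (2 ^- n) * p%:R `^ s <= (M ^ n)%:R].
Proof.
move=> /andP[s0 sn] n0 p0.
have p1 : 1 <= p%:R :> R by rewrite ler1n.
have nR0 : 0 < n%:R :> R by rewrite ltr0n.
set Y := p%:R `^ (s / n%:R); have Y1 : 1 <= Y.
  by rewrite -[leLHS](powRr0 p%:R) ler_powR// divr_ge0 ?(ltW s0) ?(ltW nR0).
have Y0 := le_trans ler01 Y1.
have YnE : Y ^+ n = p%:R `^ s by rewrite -powR_mulrn// -powRrM mulfVK ?gt_eqF.
have /andP[MY YM] := truncn_itv Y0.
have M0 : (0 < Num.truncn Y)%N by rewrite truncn_gt0.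
exists (Num.truncn Y); split => //.
- rewrite -(ler_nat R); apply: le_trans MY _.
  by rewrite -[leRHS]powRr1 ?ler0n// ler_powR// ler_pdivrMr// mul1r.
- by rewrite -YnE natrX lerXn2r// nnegrE// ler0n.
- rewrite -YnE -exprVn -exprMn natrX lerXn2r ?nnegrE ?mulr_ge0 ?invr_ge0//.
  rewrite mulrC ler_pdivrMr//; apply: le_trans (ltW YM) _.
  by rewrite -natrM ler_nat muln2 -addnn -addn1 leq_add2l.
Qed.

(** The dual box has side [L + 1] with [L = floor (p / (8 n M))]; the additional
    unit makes the lower bound on its size hold even when [L = 0], so that no
    prime has to be excluded. *)
Lemma dual_box_side (R : realType) (n M p : nat) :
  (0 < n)%N -> (0 < M)%N -> (0 < p)%N ->
  exists L : nat, [/\ (8 * (n * (M * L)) <= p)%N, (L < p)%N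
    & (8 * n%:R) ^- n * (p%:R ^+ n / (M ^ n)%:R) <= (L.+1 ^ n)%:R :> R].
Proof.
move=> n0 M0 p0; set d := (8 * n * M)%N.
have d0 : (0 < d)%N by rewrite !muln_gt0 n0.
exists (p %/ d)%N; split.
- by rewrite !mulnA mulnC leq_trunc_div.
- rewrite ltn_Pdiv// /d (@leq_trans (8 * 1 * 1))//.
  by rewrite !leq_mul.
- rewrite -exprVn !natrX -[in (M%:R ^+ n)^-1]exprVn -!exprMn.
  rewrite lerXn2r ?nnegrE ?mulr_ge0 ?invr_ge0 ?mulr_ge0 ?ler0n//.
  have -> : (8 * n%:R)^-1 * (p%:R / M%:R) = p%:R / d%:R :> R.
    by rewrite !natrM !invfM; ring.
  rewrite ler_pdivrMr ?ltr0n// -natrM ler_nat ltnW//.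
  by rewrite -ltn_divLR.
Qed.

Theorem theorem1p5 (R : realType) (n : nat) (alpha q : R) :
  (1 <= n)%N -> 0 < alpha < n%:R ->
  0 < q < (4 * n%:R - 4 * alpha + 2 * alpha) / alpha ->
  exists (C1 C2 c tau : R) (p0 : nat),
    [/\ 0 < C1, 0 < C2, 0 < c & 0 < tau] /\
    forall p : nat, prime p -> (p0 <= p)%N ->
      exists mu : 'rV['F_p]_n -> R,
        [/\ is_probability mu,
            forall x : 'rV['F_p]_n, mu x <= C1 * p%:R `^ (- alpha),
            forall xi : 'rV['F_p]_n, xi != 0 ->
              Normc.normc (fourier (fun x => (mu x)%:C) xi)
                <= C2 * p%:R `^ (- alpha / 2)
          & c * p%:R `^ tau <= Rstar mu q].
Proof.
move=> n1 /andP[alpha0 alphan] /andP[q0 qlt].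
have pi0 := @pi_gt0 R.
have nR1 : 1 <= n%:R :> R by rewrite ler1n.
set k : R := cos (pi / 4).
have k0 : 0 < k by apply: cos_gt0_pihalf; apply/andP; split; lra.
(* Rounding losses in the sizes of the box and of its dual. *)
pose A : R := 2 ^- n; pose D : R := (8 * n%:R) ^- n.
have A0 : 0 < A by rewrite invr_gt0 exprn_gt0.
have D0 : 0 < D by rewrite invr_gt0 exprn_gt0// mulr_gt0// (lt_le_trans ltr01).
pose tau : R := - (alpha / 2) * 2^-1 + (n%:R - alpha / 2) * q^-1.
have tau0 : 0 < tau.
  move: qlt; rewrite ltr_pdivlMr// => qlt.
  have -> : tau = (4 * n%:R - 4 * alpha + 2 * alpha - q * alpha) / (4 * q).
    by rewrite /tau; field; rewrite gt_eqF.
  by rewrite divr_gt0 ?mulr_gt0// subr_gt0.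
exists 2, 1, (k * (A `^ 2^-1 * D `^ q^-1)), tau, 0%N; split.
  by split=> //; rewrite ?mulr_gt0 ?powR_gt0.
move=> p pp _; have p0 := prime_gt0 pp.
have pR1 : 1 <= p%:R :> R by rewrite ler1n.
have pR0 : 0 < p%:R :> R by rewrite ltr0n.
have pD (s t : R) : p%:R `^ (s + t) = p%:R `^ s * p%:R `^ t.
  by rewrite powRD// (gt_eqF pR0) implybT.
have s_itv : 0 < alpha / 2 <= n%:R by apply/andP; split; lra.
have [M [M0 Mp MnU MnL]] := box_side s_itv n1 p0.
have [L [nML Lp Ln]] := dual_box_side R n1 M0 p0.
set E := box p n M; have cE : #|E| = (M ^ n)%N by rewrite card_box.
set F := box p n L.+1; have cF : #|F| = (L.+1 ^ n)%N by rewrite card_box.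
set a : R := p%:R `^ (- alpha); have a0 : 0 < a by rewrite powR_gt0.
have aE : #|E|%:R * a <= p%:R `^ (- alpha / 2).
  have -> : - alpha / 2 = alpha / 2 + (- alpha) by lra.
  by rewrite pD cE ler_pM2r.
have aE1 : #|E|%:R * a <= 1.
  apply: le_trans aE _; rewrite -[leRHS](powRr0 p%:R) ler_powR//; lra.
(* The uniform density that brings the total mass to 1. *)
pose b : R := (1 - #|E|%:R * a) / p%:R ^+ n.
have b0 : 0 <= b by rewrite divr_ge0 ?subr_ge0 ?exprn_ge0// ltW.
have ba : b <= a.
  apply: (@le_trans _ _ (p%:R ^- n)).
    rewrite /b ler_piMl ?invr_ge0 ?exprn_ge0 ?(ltW pR0)//.
    by rewrite gerBl mulr_ge0 ?ler0n ?(ltW a0).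
  by rewrite /a -powR_invn ?(ltW pR0)// ler_powR// lerN2 ltW.
exists (spike E a b); split.
- split=> [x|]; first by rewrite addr_ge0// mulr_ge0 ?ler0n ?(ltW a0).
  rewrite sum_spike// /b mulrC [X in _ + X]mulrC divfK ?expf_neq0 ?gt_eqF//.
  by lra.
- move=> x; rewrite /spike; case: (x \in E); rewrite /= -/a ?mul1r ?mul0r; lra.
- move=> xi xi0; rewrite mul1r; apply: le_trans aE.
  by apply: fourier_spike_le; rewrite ?(ltW a0).
have ab0 : 0 < a + b by rewrite ltr_pwDl.
have E0 : (0 < #|E|)%N by rewrite cE expn_gt0 M0.
apply: le_trans (@Rstar_knapp R p n _ q k (a + b) E F _ q0 (ltW k0) ab0 E0 _ _).
- rewrite -!(mulrA k) ler_pM2l// /tau pD mulrACA !powRrM.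
  rewrite -!powRM ?powR_ge0 ?(ltW A0) ?(ltW D0)//.
  apply: ler_pM; rewrite ?powR_ge0//; apply: ge0_ler_powR;
    rewrite ?nnegrE ?invr_ge0 ?mulr_ge0 ?powR_ge0 ?ler0n ?(ltW A0) ?(ltW D0)
            ?(ltW ab0) ?(ltW q0)//.
  + have -> : - (alpha / 2) = alpha / 2 + - alpha by lra.
    rewrite pD mulrA [leRHS]mulrC cE; apply: ler_pM => //.
    * by rewrite mulr_ge0 ?powR_ge0 ?(ltW A0).
    * exact: ltW.
    * by rewrite lerDl.
  + rewrite cF; apply: le_trans Ln.
    rewrite ler_pM2l// pD powR_mulrn ?(ltW pR0)//.
    rewrite ler_pM2l ?exprn_gt0// powRN lef_pV2 ?posrE ?powR_gt0//.
    by rewrite ltr0n expn_gt0 M0.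
- by move=> x; rewrite addr_ge0// mulr_ge0 ?ler0n ?(ltW a0).
- by move=> x xE; rewrite /spike xE mul1r.
- by move=> x xi xE xiF; exact: Re_fourier_kernel_box nML xE xiF.
Qed.
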